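(* Let $k$ be a field and $R=k[x_1,\dots,x_m]$ with a monomial order $<$. Suppose $I$ is a prime ideal of $R$ containing no monomial. Let $K\subseteq\mathbb{Z}^m$ be the lattice of toric exponents of $I$, and let $\mu:R/I\setminus\{[0]\}\to\operatorname{torfree}(\mathbb{Z}^m/K)$ be the associated map. Suppose that for every nonzero $\mathfrak a\in\operatorname{torfree}(\mathbb{Z}^m/K)$ in the image of $\mu$ there is a unique standard monomial $x^\alpha$ such that $\mu([x^\alpha])=\mathfrak a$. Then $\{[x_1],\dots,[x_m]\}$ is a Khovanskii basis for $R/I$ with respect to $\mu$.
   Context: A monomial is standard (for $I$ and $<$) if it is not the leading monomial of an element of $I$. For $[f]\in R/I$, $\tilde f$ is the normal form, i.e. the unique representative of $[f]$ that is a $k$-linear combination of standard monomials. $\mathrm{lm}$ denotes the leading (largest) monomial with respect to $<$. Toric exponent: if $f\in R$ is nonzero and not a monomial (up to scalar), and $x^{\alpha_1}>x^{\alpha_2}$ are its two largest monomials, then $\operatorname{torexp}(f)=\alpha_1-\alpha_2\in\mathbb{Z}^m$. $K\subseteq\mathbb{Z}^m$ is the subgroup generated by all $\operatorname{torexp}(f)$ with $0\ne f\in I$. $\operatorname{torfree}(\mathbb{Z}^m/K)$ is the quotient of $\mathbb{Z}^m/K$ by its torsion subgroup. For $[f]\neq[0]$, if $\mathrm{lm}(\tilde f)=x^\alpha$, then $\mu([f])$ is the image of $-\alpha$ in $\operatorname{torfree}(\mathbb{Z}^m/K)$. Order on the image of $\mu$: for $\mathfrak a,\mathfrak b$ in the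 image of $\mu$, $\mathfrak a\prec\mathfrak b$ if the smallest (with respect to $<$) monomial $x^\alpha$ with $\mu([x^\alpha])=\mathfrak a$ is greater than the smallest monomial $x^\beta$ with $\mu([x^\beta])=\mathfrak b$. For $\mathfrak a$ in the image of $\mu$, $F_{\succeq\mathfrak a}=\{[f]\ne[0]:\mu([f])\succeq\mathfrak a\}\cup\{[0]\}$ and $F_{\succ\mathfrak a}=\{[f]\neq[0]:\mu([f])\succ\mathfrak a\}\cup\{[0]\}$. The associated graded algebra is $\operatorname{gr}_\mu(R/I)=\bigoplus_{\mathfrak a}F_{\succeq\mathfrak a}/F_{\succ\mathfrak a}$ (sum over the image of $\mu$), with multiplication induced from $R/I$. A set of nonzero elements $\{g_j\}$ of $R/I$ is a Khovanskii basis with respect to $\mu$ if the images $g_j+F_{\succ\mu(g_j)}$ generate $\operatorname{gr}_\mu(R/I)$ as a $k$-algebra. *)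

(* Defs.v *)
From HB Require Import structures.
From mathcomp Require Import all_boot all_order all_algebra finmap.
From mathcomp Require Import generic_quotient ring_quotient.
From mathcomp Require Import boolp classical_sets.
From mathcomp.multinomials Require monalg.
From mathcomp.multinomials Require Export mpoly.

Set Implicit Arguments.
Unset Strict Implicit.
Unset Printing Implicit Defensive.

Import GRing.Theory.

Local Open Scope ring_scope.
Local Open Scope quotient_scope.
Local Open Scope classical_set_scope.

Notation "{ 'quot' H }" := (@Quotient.quot _ H) : type_scope.

(* MathComp quotients are taken by boolean predicates; `[< P >] turns an
   arbitrary proposition P into a boolean. *)

Section GeneratedSubgroup.
Variables (V : zmodType) (S : set V).

Definition zspan : {pred V} :=
  fun v => `[< forall H : zmodClosed V, (forall s, S s -> s \in H) -> v \in H >].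

Fact zspan_zmod_closed : zmod_closed zspan.
Proof.
split=> [|x y]; first by apply/asboolP => H _; exact: rpred0.
move=> /asboolP xS /asboolP yS; apply/asboolP => H SH.
by rewrite rpredB ?xS ?yS.
Qed.
HB.instance Definition _ := GRing.isZmodClosed.Build V zspan zspan_zmod_closed.
End GeneratedSubgroup.

Section TorsionFreeQuotient.
Variable V : zmodType.

Definition torsion : {pred V} :=
  fun v => `[< exists2 n : nat, (0 < n)%N & v *+ n = 0 >].

Fact torsion_zmod_closed : zmod_closed torsion.
Proof.
split=> [|x y]; first by apply/asboolP; exists 1%N.
move=> /asboolP[a a0 xa] /asboolP[b b0 yb]; apply/asboolP; exists (a * b)%N.
  by rewrite muln_gt0 a0.
by rewrite mulrnBl mulrnA xa mul0rn mulnC mulrnA yb mul0rn subr0.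
Qed.
HB.instance Definition _ :=
  GRing.isZmodClosed.Build V torsion torsion_zmod_closed.

Definition torfree : zmodType := {quot torsion}.
End TorsionFreeQuotient.

(* ring_quotient only equips the quotient of a commutative ring by an ideal
   with a ring structure; here it becomes an algebra. *)
Section QuotientAlgebra.
Variables (k : fieldType) (R : comAlgType k) (I : idealr R).
Local Notation Q := {quot I}.

Definition cls (x : R) : Q := \pi_Q x.

Lemma cls_surj (z : Q) : exists x, z = cls x.
Proof. by exists (repr z); rewrite /cls reprK. Qed.

Lemma eq_cls x y : (cls x = cls y) <-> (x - y \in I).
Proof.
split; last by rewrite Quotient.idealrBE => /eqP.
by move=> e; rewrite Quotient.idealrBE; apply/eqP.
Qed.

Fact cls_zmod_morphism : zmod_morphism cls.
Proof. exact: (@pi_is_zmod_morphism R _ _ Q). Qed.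
Fact cls_monoid_morphism : monoid_morphism cls.
Proof. exact: (@pi_is_monoid_morphism R _ _ Q). Qed.
HB.instance Definition _ := GRing.isZmodMorphism.Build R Q cls cls_zmod_morphism.
HB.instance Definition _ :=
  GRing.isMonoidMorphism.Build R Q cls cls_monoid_morphism.

Definition qscale (c : k) (z : Q) : Q := cls (c *: (repr z : R)).

Fact cls_qscale c (x : R) : cls (c *: x) = qscale c (cls x).
Proof.
apply/eq_cls; rewrite -scalerBr -mulr_algl; apply: idealMr.
by apply/eq_cls; rewrite /cls reprK.
Qed.

Fact qscaleA a b z : qscale a (qscale b z) = qscale (a * b) z.
Proof. by have [x ->] := cls_surj z; rewrite -!cls_qscale scalerA. Qed.
Fact qscale1 : left_id 1 qscale.
Proof. by move=> z; have [x ->] := cls_surj z; rewrite -cls_qscale scale1r. Qed.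
Fact qscaleDr : right_distributive qscale +%R.
Proof.
move=> a z t; have [x ->] := cls_surj z; have [y ->] := cls_surj t.
by rewrite -rmorphD -!cls_qscale scalerDr rmorphD.
Qed.
Fact qscaleDl z : {morph qscale^~ z : a b / a + b}.
Proof.
by move=> a b; have [x ->] := cls_surj z; rewrite -!cls_qscale scalerDl rmorphD.
Qed.
HB.instance Definition _ := GRing.Zmodule_isLmodule.Build k (Quotient.quot I)
  qscaleA qscale1 qscaleDr qscaleDl.

Lemma clsZ c x : cls (c *: x) = c *: cls x.
Proof. exact: cls_qscale. Qed.
HB.instance Definition _ := GRing.isScalable.Build k R Q *:%R cls clsZ.

Fact qscaleAl a (z t : Q) : a *: (z * t) = (a *: z) * t.
Proof.
have [x ->] := cls_surj z; have [y ->] := cls_surj t.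
by rewrite -rmorphM -!clsZ -rmorphM scalerAl.
Qed.
HB.instance Definition _ :=
  GRing.Lmodule_isLalgebra.Build k (Quotient.quot I) qscaleAl.
Fact qscaleAr a (z t : Q) : a *: (z * t) = z * (a *: t).
Proof. by rewrite mulrC qscaleAl mulrC. Qed.
HB.instance Definition _ :=
  GRing.Lalgebra_isAlgebra.Build k (Quotient.quot I) qscaleAr.
End QuotientAlgebra.

(* The group algebra A[G] of an abelian group G: finitely supported functions
   from G to A with the convolution product.  (monalg only multiplies when the
   monoid of exponents has no nontrivial unit.) *)
Definition grpalg (k : fieldType) (G : zmodType) (A : comAlgType k) :=
  monalg.malg G A.
Section GroupAlgebraZmodule.
Import monalg.
HB.instance Definition _ (k : fieldType) (G : zmodType) (A : comAlgType k) :=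
  GRing.Zmodule.on (grpalg G A).
End GroupAlgebraZmodule.

Section GroupAlgebra.
Variables (k : fieldType) (G : zmodType) (A : comAlgType k).

Definition gcoef (f : grpalg G A) (a : G) : A := monalg.mcoeff a f.
Definition gmono (x : A) (a : G) : grpalg G A := monalg.mkmalgU a x.

Implicit Types (f g h : grpalg G A) (a b : G) (x y : A).

Lemma grpalgP f g : gcoef f =1 gcoef g -> f = g.
Proof. by move=> fg; apply/monalg.malgP. Qed.

Lemma gcoef0 a : gcoef 0 a = 0. Proof. exact: monalg.mcoeff0. Qed.
Lemma gcoefD f g a : gcoef (f + g) a = gcoef f a + gcoef g a.
Proof. exact: monalg.mcoeffD. Qed.
Lemma gcoefN f a : gcoef (- f) a = - gcoef f a.
Proof. exact: monalg.mcoeffN. Qed.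
Lemma gcoefB f g a : gcoef (f - g) a = gcoef f a - gcoef g a.
Proof. exact: monalg.mcoeffB. Qed.
Lemma gcoef_sum (T : Type) (s : seq T) (F : T -> grpalg G A) a :
  gcoef (\sum_(i <- s) F i) a = \sum_(i <- s) gcoef (F i) a.
Proof. exact: (big_morph (gcoef^~ a) (fun f g => gcoefD f g a) (gcoef0 a)). Qed.
Lemma gcoef_mono x a b : gcoef (gmono x a) b = if a == b then x else 0.
Proof. by rewrite /gcoef monalg.mcoeffU; case: eqP. Qed.

Lemma gmono0 a : gmono 0 a = 0. Proof. exact: monalg.monalgU0. Qed.
Lemma gmonoD x y a : gmono (x + y) a = gmono x a + gmono y a.
Proof. exact: monalg.monalgUD. Qed.

Definition gsupp f : seq G := enum_fset (monalg.msupp f).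
Lemma gsupp_uniq f : uniq (gsupp f). Proof. exact: fset_uniq. Qed.
Lemma mem_gsupp f a : (a \in gsupp f) = (gcoef f a != 0).
Proof. by rewrite monalg.mcoeff_neq0. Qed.

Lemma gmonoE f : f = \sum_(a <- gsupp f) gmono (gcoef f a) a.
Proof. exact: monalg.monalgE. Qed.

(* sums over a support may be taken over any larger list *)
Lemma sum_gsupp f (s : seq G) (F : G -> grpalg G A) :
    uniq s -> {subset gsupp f <= s} -> (forall a, gcoef f a = 0 -> F a = 0) ->
  \sum_(a <- gsupp f) F a = \sum_(a <- s) F a.
Proof.
move=> us sub F0; rewrite [RHS](bigID (mem (gsupp f))) /= [X in _ + X]big1.
  rewrite addr0 -[RHS]big_filter; apply: perm_big.
  apply: uniq_perm; rewrite ?filter_uniq ?gsupp_uniq // => a.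
  by rewrite mem_filter; case: (boolP (a \in gsupp f)) => //= /sub ->.
by move=> a; rewrite mem_gsupp negbK => /eqP /F0.
Qed.

Definition gmul f g : grpalg G A :=
  \sum_(a <- gsupp f) \sum_(b <- gsupp g) gmono (gcoef f a * gcoef g b) (a + b).

Definition gscale (c : k) f : grpalg G A :=
  \sum_(a <- gsupp f) gmono (c *: gcoef f a) a.

Lemma gcoefZ c f a : gcoef (gscale c f) a = c *: gcoef f a.
Proof.
rewrite gcoef_sum; have [af|af] := boolP (a \in gsupp f).
  rewrite (bigD1_seq a) ?gsupp_uniq //= gcoef_mono eqxx big1 ?addr0 // => b.
  by rewrite gcoef_mono => /negPf ->.
rewrite big1_seq => [|b /= bf].
  by move: af; rewrite mem_gsupp negbK => /eqP ->; rewrite scaler0.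
by rewrite gcoef_mono; case: eqP bf af => // -> ->.
Qed.

Lemma gcoefM f g c :
  gcoef (gmul f g) c = \sum_(a <- gsupp f) gcoef f a * gcoef g (c - a).
Proof.
rewrite gcoef_sum; apply: eq_bigr => a _; rewrite gcoef_sum.
have E b : (a + b == c) = (b == c - a) by rewrite [RHS]eq_sym subr_eq addrC eq_sym.
have [cg|cg] := boolP (c - a \in gsupp g).
  rewrite (bigD1_seq (c - a)) ?gsupp_uniq //= gcoef_mono E eqxx big1 ?addr0 //.
  by move=> b; rewrite gcoef_mono E => /negPf ->.
rewrite big1_seq => [|b /= bg].
  by move: cg; rewrite mem_gsupp negbK => /eqP ->; rewrite mulr0.
by rewrite gcoef_mono E; case: eqP bg cg => // -> ->.
Qed.

Fact gmulDl : left_distributive gmul +%R.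
Proof.
move=> f g h; pose s := undup (gsupp f ++ gsupp g ++ gsupp (f + g)).
have us : uniq s by exact: undup_uniq.
pose F f' a := \sum_(b <- gsupp h) gmono (gcoef f' a * gcoef h b) (a + b).
have F0 f' a : gcoef f' a = 0 -> F f' a = 0.
  by move=> e; rewrite /F big1 // => b _; rewrite e mul0r gmono0.
rewrite /gmul !(@sum_gsupp _ s (F _)) //; try exact: F0;
  try by move=> a; rewrite mem_undup !mem_cat => ->; rewrite ?orbT.
rewrite -big_split; apply: eq_bigr => a _; rewrite -big_split.
by apply: eq_bigr => b _; rewrite gcoefD mulrDl gmonoD.
Qed.

Fact gmulC : commutative gmul.
Proof.
move=> f g; rewrite /gmul exchange_big; apply: eq_bigr => b _.
by apply: eq_bigr => a _; rewrite addrC mulrC.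
Qed.

Fact gmulDr : right_distributive gmul +%R.
Proof. by move=> f g h; rewrite ![gmul f _]gmulC gmulDl. Qed.

Fact gmul0 f : gmul 0 f = 0.
Proof. by apply: (addrI (gmul 0 f)); rewrite -gmulDl !addr0. Qed.

Fact gmulM x y a b : gmul (gmono x a) (gmono y b) = gmono (x * y) (a + b).
Proof.
have S z c : {subset gsupp (gmono z c) <= [:: c]}.
  move=> d; rewrite mem_gsupp gcoef_mono inE eq_sym.
  by case: (eqVneq d c) => //= _; rewrite eqxx.
rewrite /gmul (@sum_gsupp _ [:: a]) //; last first.
  by move=> c e; rewrite big1 // => d _; rewrite e mul0r gmono0.
rewrite big_seq1 (@sum_gsupp _ [:: b]) //; last first.
  by move=> c e; rewrite e mulr0 gmono0.
by rewrite big_seq1 !gcoef_mono !eqxx.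
Qed.

Fact gmulA : associative gmul.
Proof.
have suml h (T : Type) (s : seq T) (F : T -> grpalg G A) :
    gmul (\sum_(i <- s) F i) h = \sum_(i <- s) gmul (F i) h.
  by apply: (big_morph (gmul^~ h)) => [? ?|]; [exact: gmulDl|exact: gmul0].
have sumr h (T : Type) (s : seq T) (F : T -> grpalg G A) :
    gmul h (\sum_(i <- s) F i) = \sum_(i <- s) gmul h (F i).
  by rewrite gmulC suml; apply: eq_bigr => i _; rewrite gmulC.
move=> f g h; rewrite [f]gmonoE [g]gmonoE [h]gmonoE.
rewrite !suml; apply: eq_bigr => a _.
rewrite [LHS]sumr [gmul (gmono _ _) _ in RHS]sumr suml; apply: eq_bigr => b _.
by rewrite !sumr; apply: eq_bigr => c _; rewrite !gmulM mulrA addrA.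
Qed.

Definition gone : grpalg G A := gmono 1 0.
Fact gmul1 : left_id gone gmul.
Proof.
move=> f; rewrite [f in LHS]gmonoE /gone gmulC.
rewrite (big_morph (gmul^~ (gmono 1 0)) (fun g h => gmulDl g h _) (gmul0 _)) /=.
by rewrite [RHS]gmonoE; apply: eq_bigr => a _; rewrite gmulM mulr1 addr0.
Qed.
Fact gone_neq0 : gone != 0.
Proof.
apply/eqP => /(congr1 (gcoef^~ 0)); rewrite gcoef_mono eqxx gcoef0.
by apply/eqP/oner_neq0.
Qed.
HB.instance Definition _ := GRing.Zmodule_isComNzRing.Build (grpalg G A)
  gmulA gmulC gmul1 gmulDl gone_neq0.

Fact gscaleA (a b : k) f : gscale a (gscale b f) = gscale (a * b) f.
Proof. by apply: grpalgP => c; rewrite !gcoefZ scalerA. Qed.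
Fact gscale1 : left_id 1 gscale.
Proof. by move=> f; apply: grpalgP => c; rewrite !gcoefZ scale1r. Qed.
Fact gscaleDr : right_distributive gscale +%R.
Proof.
by move=> a f g; apply: grpalgP => c; rewrite !(gcoefZ, gcoefD) scalerDr.
Qed.
Fact gscaleDl f : {morph gscale^~ f : a b / a + b}.
Proof.
by move=> a b; apply: grpalgP => c; rewrite !(gcoefZ, gcoefD) scalerDl.
Qed.
HB.instance Definition _ := GRing.Zmodule_isLmodule.Build k (grpalg G A)
  gscaleA gscale1 gscaleDr gscaleDl.

Fact gscaleAl c f g : c *: (f * g) = (c *: f) * g.
Proof.
have E h : c *: h = gmono (c%:A) 0 * h.
  rewrite [h in RHS]gmonoE mulr_sumr; apply: eq_bigr => a _.
  by rewrite [RHS]gmulM add0r mulr_algl.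
by rewrite !E mulrA.
Qed.
HB.instance Definition _ :=
  GRing.Lmodule_isLalgebra.Build k (grpalg G A) gscaleAl.
Fact gscaleAr (a : k) f g : a *: (f * g) = f * (a *: g).
Proof. by rewrite mulrC gscaleAl mulrC. Qed.
HB.instance Definition _ :=
  GRing.Lalgebra_isAlgebra.Build k (grpalg G A) gscaleAr.
End GroupAlgebra.

(* A decreasing pair of filtrations Fge, Fgt of an algebra, indexed by G: the
   conditions under which \bigoplus_a Fge a / Fgt a is a k-algebra for the
   multiplication induced from A.  The last one says that this algebra is
   nontrivial, as every MathComp ring obtained by an ideal quotient is. *)
Record is_filtration (k : fieldType) (G : zmodType) (A : comAlgType k)
    (Fge Fgt : G -> set A) : Prop := {
  fge0 : forall a, Fge a 0;
  fgt0 : forall a, Fgt a 0;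
  fge_linear : forall a (c : k) x y, Fge a x -> Fge a y -> Fge a (c *: x + y);
  fgt_linear : forall a (c : k) x y, Fgt a x -> Fgt a y -> Fgt a (c *: x + y);
  fgt_ge : forall a x, Fgt a x -> Fge a x;
  fgeM : forall a b x y, Fge a x -> Fge b y -> Fge (a + b) (x * y);
  fgtM : forall a b x y, Fge a x -> Fgt b y -> Fgt (a + b) (x * y);
  fge1 : Fge 0 1;
  fgt1 : ~ Fgt 0 1
}.

(* The associated graded algebra, realised as
   (\bigoplus_a Fge a) / (\bigoplus_a Fgt a), where \bigoplus_a Fge a is the
   subalgebra of A[G] of the functions whose value at a lies in Fge a.  The
   lemmas gr_in_eq, gr_in_span and gr_in_free below identify it with
   \bigoplus_a Fge a / Fgt a, and gr_inM describes its product. *)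
Section AssociatedGraded.
Variables (k : fieldType) (G : zmodType) (A : comAlgType k).
Variables (Fge Fgt : G -> set A) (H : is_filtration Fge Fgt).

Definition in_sum_ge of is_filtration Fge Fgt : {pred grpalg G A} :=
  fun f => `[< forall a, Fge a (gcoef f a) >].

Lemma fge_sum a (T : eqType) (s : seq T) (F : T -> A) :
  (forall i, i \in s -> Fge a (F i)) -> Fge a (\sum_(i <- s) F i).
Proof.
move=> sF; rewrite big_seq; elim/big_rec: _ => [|i x /sF iF xF].
  exact: (fge0 H).
by rewrite -[F i]scale1r; apply: (fge_linear H).
Qed.

Lemma fgt_sum a (T : eqType) (s : seq T) (F : T -> A) :
  (forall i, i \in s -> Fgt a (F i)) -> Fgt a (\sum_(i <- s) F i).
Proof.
move=> sF; rewrite big_seq; elim/big_rec: _ => [|i x /sF iF xF].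
  exact: (fgt0 H).
by rewrite -[F i]scale1r; apply: (fgt_linear H).
Qed.

Fact in_sum_ge_subalg_closed : subalg_closed (in_sum_ge H).
Proof.
split=> [|c f g /asboolP fF /asboolP gF|f g /asboolP fF /asboolP gF].
- apply/asboolP => a; rewrite gcoef_mono; case: eqP => [<-|_].
    exact: (fge1 H).
  exact: (fge0 H).
- by apply/asboolP => a; rewrite gcoefD gcoefZ; apply: (fge_linear H).
apply/asboolP => a; rewrite gcoefM; apply: fge_sum => b _.
by rewrite -{1}(subrK b a) addrC; apply: (fgeM H).
Qed.
HB.instance Definition _ := GRing.isSubalgClosed.Build k (grpalg G A)
  (in_sum_ge H) (GRing.subalg_closed_semi in_sum_ge_subalg_closed).

Record sum_ge := SumGe { sum_ge_val : grpalg G A; _ : sum_ge_val \in in_sum_ge H }.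
HB.instance Definition _ := [isSub for sum_ge_val].
HB.instance Definition _ := [Choice of sum_ge by <:].
HB.instance Definition _ := [SubChoice_isSubAlgebra of sum_ge by <:].
HB.instance Definition _ := [SubNzRing_isSubComNzRing of sum_ge by <:].

Definition in_sum_gt : {pred sum_ge} :=
  fun f => `[< forall a, Fgt a (gcoef (val f) a) >].

Fact in_sum_gt_idealr_closed : idealr_closed in_sum_gt.
Proof.
split=> [||f g h /asboolP gF /asboolP hF].
- by apply/asboolP => a; rewrite rmorph0 gcoef0; apply: (fgt0 H).
- apply/asboolP => /(_ 0); rewrite rmorph1 gcoef_mono eqxx.
  exact: (fgt1 H).
have /asboolP fF := valP f.
apply/asboolP => a; rewrite rmorphD rmorphM gcoefD gcoefM.
rewrite -[X in X + _]scale1r; apply: (fgt_linear H) => //.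
apply: fgt_sum => b _; rewrite -{1}(subrK b a) addrC.
by apply: (fgtM H).
Qed.
HB.instance Definition _ :=
  isIdealr.Build sum_ge in_sum_gt in_sum_gt_idealr_closed.

Definition gr : comAlgType k := {quot in_sum_gt}.

Let sgvD (f g : sum_ge) : val (f + g) = val f + val g. Proof. exact: rmorphD. Qed.
Let sgvB (f g : sum_ge) : val (f - g) = val f - val g. Proof. exact: rmorphB. Qed.
Let sgvM (f g : sum_ge) : val (f * g) = gmul (val f) (val g).
Proof. exact: rmorphM. Qed.
Let sgvZ (c : k) (f : sum_ge) : val (c *: f) = gscale c (val f).
Proof. exact: linearZ. Qed.
Let sgv_sum (T : Type) (s : seq T) (F : T -> sum_ge) :
  val (\sum_(i <- s) F i) = \sum_(i <- s) val (F i).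
Proof. exact: rmorph_sum. Qed.

(* The class x + Fgt a in the component of degree a (0 when x is not in Fge a). *)
Definition gr_in (a : G) (x : A) : gr :=
  cls in_sum_gt (insubd (0 : sum_ge) (gmono x a)).

Lemma gr_inE a x : Fge a x ->
  exists2 f : sum_ge, gr_in a x = cls in_sum_gt f & val f = gmono x a.
Proof.
move=> xF; exists (insubd (0 : sum_ge) (gmono x a)) => //; rewrite insubdK //.
apply/asboolP => b; rewrite gcoef_mono; case: eqP => [<-//|_].
exact: (fge0 H).
Qed.

Lemma gr_in_eq a x y : Fge a x -> Fge a y ->
  (gr_in a x = gr_in a y) <-> Fgt a (x - y).
Proof.
move=> /gr_inE[f -> fE] /gr_inE[g -> gE]; rewrite eq_cls; split.
  by move/asboolP/(_ a); rewrite sgvB fE gE gcoefB !gcoef_mono eqxx.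
move=> xy; apply/asboolP => b; rewrite sgvB fE gE gcoefB !gcoef_mono.
by case: eqP => [<-//|_]; rewrite subrr; apply: (fgt0 H).
Qed.

Lemma gr_in_linear a (c : k) x y : Fge a x -> Fge a y ->
  gr_in a (c *: x + y) = c *: gr_in a x + gr_in a y.
Proof.
move=> xF yF; have [h -> hE] := gr_inE (fge_linear H c xF yF).
have [f -> fE] := gr_inE xF; have [g -> gE] := gr_inE yF.
rewrite -clsZ -rmorphD; congr (cls _ _); apply: val_inj.
rewrite sgvD sgvZ fE gE hE.
apply: grpalgP => b; rewrite gcoefD gcoefZ !gcoef_mono.
by case: eqP; rewrite // scaler0 addr0.
Qed.

Lemma gr_in1 : gr_in 0 1 = 1.
Proof.
have [f -> fE] := gr_inE (fge1 H); rewrite -[RHS](rmorph1 (cls in_sum_gt)).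
by congr (cls _ _); apply: val_inj; rewrite fE.
Qed.

Lemma gr_inM a b x y : Fge a x -> Fge b y ->
  gr_in a x * gr_in b y = gr_in (a + b) (x * y).
Proof.
move=> xF yF; have [h -> hE] := gr_inE (fgeM H xF yF).
have [f -> fE] := gr_inE xF; have [g -> gE] := gr_inE yF.
rewrite -rmorphM; congr (cls _ _); apply: val_inj.
by rewrite sgvM fE gE hE gmulM.
Qed.

Lemma gr_in_span (z : gr) : exists2 s : seq G, uniq s &
  exists2 x : G -> A, (forall a, Fge a (x a)) & z = \sum_(a <- s) gr_in a (x a).
Proof.
have [f ->] := cls_surj z; have /asboolP fF := valP f.
exists (gsupp (val f)); first exact: gsupp_uniq.
exists (gcoef (val f)) => //.
rewrite -(rmorph_sum (cls in_sum_gt)); congr (cls _ _); apply: val_inj.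
rewrite sgv_sum [LHS]gmonoE; apply: eq_bigr => a _.
rewrite insubdK //; apply/asboolP => b; rewrite gcoef_mono.
by case: eqP => [<-//|_]; apply: (fge0 H).
Qed.

Lemma gr_in_free (s : seq G) (x : G -> A) : uniq s ->
    (forall a, Fge a (x a)) -> \sum_(a <- s) gr_in a (x a) = 0 ->
  forall a, a \in s -> Fgt a (x a).
Proof.
move=> us xF; rewrite -(rmorph_sum (cls in_sum_gt)) -(rmorph0 (cls in_sum_gt)).
move/eq_cls; rewrite subr0 => /asboolP sF a sa; move: (sF a).
rewrite sgv_sum gcoef_sum (bigD1_seq a) //= big1 => [|b ba].
  rewrite addr0 insubdK ?gcoef_mono ?eqxx //.
  apply/asboolP => b; rewrite gcoef_mono.
  by case: eqP => [<-//|_]; apply: (fge0 H).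
rewrite insubdK ?gcoef_mono ?(negPf ba) //.
apply/asboolP => c; rewrite gcoef_mono.
by case: eqP => [<-//|_]; apply: (fge0 H).
Qed.
End AssociatedGraded.

Section AlgebraGeneration.
Variables (k : fieldType) (B : algType k) (S : set B).

Definition generates_algebra : Prop :=
  forall P : {pred B}, subalg_closed P -> (forall s, S s -> s \in P) ->
  forall z, z \in P.
End AlgebraGeneration.

Definition monomial_order m (le : rel 'X_{1..m}) : Prop :=
  [/\ total le, antisymmetric le, transitive le,
      (forall a b c, le a b -> le (a + c)%MM (b + c)%MM)
    & well_founded (fun a b => (a != b) && le a b)].

Section ToricExponents.
Variables (k : fieldType) (m : nat) (le : rel 'X_{1..m}).
Implicit Types (f : {mpoly k[m]}) (a : 'X_{1..m}).

Definition monomials_decreasing f : seq 'X_{1..m} :=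
  sort (fun a b => le b a) (msupp f).

(* junk value 0 for f = 0 *)
Definition lm f : 'X_{1..m} := nth 0%MM (monomials_decreasing f) 0.

Definition expv a : 'rV[int]_m := \row_i (a i)%:Z.

(* meaningful when f has at least two monomials *)
Definition torexp f : 'rV[int]_m :=
  expv (nth 0%MM (monomials_decreasing f) 0)
  - expv (nth 0%MM (monomials_decreasing f) 1).
End ToricExponents.

Section Mu.
Variables (k : fieldType) (m : nat) (le : rel 'X_{1..m}).
Variable I : idealr {mpoly k[m]}.
Local Notation R := {mpoly k[m]}.

Definition coordring : comAlgType k := {quot I}.

Definition standard (a : 'X_{1..m}) : Prop :=
  ~ exists f : R, [/\ f \in I, f != 0 & lm le f = a].

Definition nf (z : coordring) : R :=
  xget 0 [set f : R | cls I f = z /\ forall a, a \in msupp f -> standard a].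

Definition toric_lattice : {pred 'rV[int]_m} :=
  zspan [set v | exists f : R,
    [/\ f \in I, (1 < size (msupp f))%N & v = torexp le f]].
HB.instance Definition _ := GRing.ZmodClosed.on toric_lattice.

Definition tf : zmodType := torfree {quot toric_lattice}.

(* only meaningful for z != 0 *)
Definition mu (z : coordring) : tf :=
  \pi_tf (\pi_{quot toric_lattice} (- expv (lm le (nf z)))).

Definition mu_image (a : tf) : Prop := exists2 z : coordring, z != 0 & mu z = a.

Definition cls_monomial (a : 'X_{1..m}) : coordring := cls I 'X_[k, a].

Definition smallest_monomial (g : tf) (a : 'X_{1..m}) : Prop :=
  mu (cls_monomial a) = g /\
  forall b : 'X_{1..m}, mu (cls_monomial b) = g -> le a b.

Definition mu_lt (g h : tf) : Prop :=
  exists a b : 'X_{1..m}, [/\ smallest_monomial g a, smallest_monomial h b,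
    a != b & le b a].

Definition mu_le (g h : tf) : Prop := g = h \/ mu_lt g h.

(* For g outside the image of mu these two sets are {0} (F_ge_outside), so
   that a direct sum over all g is a direct sum over the image. *)
Definition F_ge (g : tf) : set coordring :=
  [set z | (z != 0 /\ mu_le g (mu z)) \/ z = 0].

Definition F_gt (g : tf) : set coordring :=
  [set z | (z != 0 /\ mu_lt g (mu z)) \/ z = 0].

Lemma F_ge_outside (g : tf) (z : coordring) :
  (forall a, 'X_[k, a] \notin I) -> ~ mu_image g -> F_ge g z -> z = 0.
Proof.
move=> noX gNim [[z0 gz]|//]; case: gNim; case: gz => [->|]; first by exists z.
case=> a [b [[<- _] _ _ _]]; exists (cls_monomial a) => //.
apply/eqP => /esym; rewrite -[0](rmorph0 (cls I)) => /esym /eq_cls.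
by rewrite subr0; apply/negP/noX.
Qed.

(* The existential asserts that the F_ge g / F_gt g do assemble into an
   algebra; is_filtration is a proposition, so gr does not depend on H. *)
Definition khovanskii_basis (S : set coordring) : Prop :=
  (forall s, S s -> s != 0) /\
  exists H : is_filtration F_ge F_gt,
    generates_algebra [set gr_in H (mu s) s | s in S].

End Mu.

(* Main.v *)
Require Import Defs.
From HB Require Import structures.
From mathcomp Require Import all_boot all_order all_algebra.
From mathcomp Require Import generic_quotient ring_quotient.
From mathcomp Require Import boolp classical_sets.
Set Implicit Arguments.
Unset Strict Implicit.
Unset Printing Implicit Defensive.

Import GRing.Theory.
Local Open Scope ring_scope.
Local Open Scope quotient_scope.
Local Open Scope classical_set_scope.

(** Write [K] for the lattice of toric exponents and order [Z^m] by the unique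
    group order that extends the monomial order.  The key point is that [K] is a
    convex subgroup of [Z^m].  Indeed, let [f] in the ideal have largest
    monomials [x^a > x^b].  If [0 < c - d < a - b], then [f * (x^c + x^d)] is in
    the ideal and has largest monomials [x^(a + c) > x^(a + d)], so that [c - d]
    is a toric exponent too ([toric_lattice_below]).  Since [K] is generated by
    the toric exponents, convexity follows ([toric_lattice_convex]).

    Hence [Z^m / K] is torsion-free and is itself a totally ordered group, whose
    nonnegative cone is [nonneg_mod].  As the ideal contains no monomial,
    reducing a monomial to its normal form changes its leading exponent by a
    toric exponent at most, so that [mu] sends the class of [x^a] to the class
    of [- a] ([mu_monomial]).  Comparing smallest monomials amounts to comparing
    exponents in the ordered group [Z^m / K] ([mu_ltP]), and thus the filtration
    has a description without normal forms ([F_geP], [F_gtP]): an element has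
    value at least the class of [- a] exactly when it is represented by a
    polynomial all of whose exponents are at most [a] modulo [K].  From this the
    filtration is visibly multiplicative ([F_filtration]).

    Finally, such a representative writes an element of the component of degree
    [- a] as a combination of classes of monomials; the monomials of exponent
    strictly below [a] modulo [K] vanish in the graded algebra, and the others
    are products of the classes of the variables ([gr_monomial_generated]). *)

(** * The order on exponent vectors *)

Lemma expvD m (a b : 'X_{1..m}) : expv (a + b)%MM = expv a + expv b.
Proof. by apply/rowP => i; rewrite !mxE mnmDE PoszD. Qed.

Lemma expv_inj m : injective (@expv m).
Proof.
by move=> a b /rowP e; apply/mnmP => i; have := e i; rewrite !mxE => -[].
Qed.

Lemma expv_subE m (a b c d : 'X_{1..m}) :
  expv a - expv b = expv c - expv d -> (a + d = b + c)%MM.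
Proof.
move=> e; apply: expv_inj.
by rewrite !expvD -[expv a](subrK (expv b)) e addrAC subrK addrC.
Qed.

Lemma expv_sub_surj m (v : 'rV[int]_m) : exists a b, v = expv a - expv b.
Proof.
exists [multinom (if (0 <= v ord0 i)%R then `|v ord0 i|%N else 0%N) | i < m].
exists [multinom (if (0 <= v ord0 i)%R then 0%N else `|v ord0 i|%N) | i < m].
apply/rowP => i; rewrite !mxE !mnmE.
by case: (v ord0 i) => n //=; rewrite ?subr0 // add0r NegzE.
Qed.

Section MonomialOrder.
Variables (m : nat) (le : rel 'X_{1..m}) (mo : monomial_order le).
Implicit Types (a b c d : 'X_{1..m}) (u v w : 'rV[int]_m).

Lemma mle_refl a : le a a.
Proof. by case: mo => tot _ _ _ _; have := tot a a; rewrite orbb. Qed.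

Lemma mle_anti a b : le a b -> le b a -> a = b.
Proof. by case: mo => _ anti _ _ _ ab ba; apply: anti; rewrite ab. Qed.

Lemma mle_trans b a c : le a b -> le b c -> le a c.
Proof. by case: mo => _ _ tr _ _; apply: tr. Qed.

Lemma mle_total a b : le a b || le b a.
Proof. by case: mo. Qed.

Lemma mle_add2r c a b : le (a + c)%MM (b + c)%MM = le a b.
Proof.
case: mo => _ _ _ mono _; apply/idP/idP => [abc|]; last exact: mono.
have /orP[//|ba] := mle_total a b.
by have /addIm -> := mle_anti abc (mono _ _ c ba); apply: mle_refl.
Qed.

Lemma mle_add2l c a b : le (c + a)%MM (c + b)%MM = le a b.
Proof. by rewrite ![(c + _)%MM]addmC mle_add2r. Qed.

(** The positive cone of the unique group order on the exponent lattice that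
    extends the monomial order. *)
Definition nonneg v := exists a b, v = expv a - expv b /\ le b a.

Lemma nonneg_expv a b : nonneg (expv a - expv b) <-> le b a.
Proof.
split=> [[c [d [/expv_subE e dc]]]|]; last by exists a, b.
by rewrite -(mle_add2r d) e mle_add2l.
Qed.

Lemma nonneg0 : nonneg 0.
Proof. by rewrite -(subrr (expv 0%MM)); apply/nonneg_expv/mle_refl. Qed.

Lemma nonnegD u v : nonneg u -> nonneg v -> nonneg (u + v).
Proof.
move=> [a [b [-> ba]]] [c [d [-> dc]]].
exists (a + c)%MM, (b + d)%MM; rewrite !expvD opprD addrACA; split=> //.
by apply: (@mle_trans (a + d)%MM); rewrite ?mle_add2r ?mle_add2l.
Qed.

Lemma nonneg_total v : nonneg v \/ nonneg (- v).
Proof.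
have [a [b ->]] := expv_sub_surj v; rewrite opprB.
by case/orP: (mle_total a b) => ?; [right|left]; apply/nonneg_expv.
Qed.

Lemma nonneg_anti v : nonneg v -> nonneg (- v) -> v = 0.
Proof.
have [a [b ->]] := expv_sub_surj v; rewrite opprB !nonneg_expv => ba ab.
by rewrite (mle_anti ab ba) subrr.
Qed.
End MonomialOrder.

(** * Leading terms and toric exponents *)

Section LeadingTerms.
Variables (k : fieldType) (m : nat) (le : rel 'X_{1..m}).
Variable mo : monomial_order le.
Implicit Types (f : {mpoly k[m]}) (a b c : 'X_{1..m}).

Let mge_trans : transitive (fun a b => le b a).
Proof. by move=> x y z yx xz; apply: (mle_trans mo) xz yx. Qed.

Lemma monomials_decreasing_sorted f :
  sorted (fun a b => le b a) (monomials_decreasing le f).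
Proof. by apply: sort_sorted => a b; apply: (mle_total mo). Qed.

Lemma mem_monomials_decreasing f : monomials_decreasing le f =i msupp f.
Proof. exact: mem_sort. Qed.

Lemma lm_max f a : a \in msupp f ->
  lm le f \in msupp f /\ (forall b, b \in msupp f -> le b (lm le f)).
Proof.
rewrite /lm; move: (monomials_decreasing_sorted f) (mem_monomials_decreasing f).
case: (monomials_decreasing le f) => [|s0 s] /= srt memf; first by rewrite -memf.
move=> _; split=> [|b]; first by rewrite -memf mem_head.
rewrite -memf inE => /predU1P[->|bs]; first exact: (mle_refl mo).
by have /allP := order_path_min mge_trans srt; apply.
Qed.

Lemma lm_mem f : f != 0 -> lm le f \in msupp f.
Proof.
rewrite -msupp_eq0; case E: (msupp f) => [|a s] // _; rewrite -E.
by have [] := @lm_max f a; rewrite ?E ?mem_head.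
Qed.

Lemma le_lm f b : b \in msupp f -> le b (lm le f).
Proof. by move=> bf; have [_ ->] := lm_max bf. Qed.

Lemma lm_unique f a : a \in msupp f -> (forall b, b \in msupp f -> le b a) ->
  lm le f = a.
Proof.
move=> af amax; have [lf ltop] := lm_max af.
by apply: (mle_anti mo); [exact: amax|exact: ltop].
Qed.

Definition two_largest f a b : Prop :=
  [/\ a \in msupp f, b \in msupp f, a != b, le b a
    & forall c, c \in msupp f -> c = a \/ le c b].

Lemma torexp_two_largest f a b :
  two_largest f a b -> torexp le f = expv a - expv b.
Proof.
case=> af bf ab ba top; rewrite /torexp.
have lmE : nth 0%MM (monomials_decreasing le f) 0 = a.
  apply: lm_unique => // c /top[->|cb]; first exact: (mle_refl mo).
  exact: (mle_trans mo) cb ba.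
rewrite lmE; move: lmE.
move: (monomials_decreasing_sorted f) (mem_monomials_decreasing f).
have : uniq (monomials_decreasing le f) by rewrite sort_uniq msupp_uniq.
case: (monomials_decreasing le f) => [|s0 [|s1 s]] /=.
- by move=> _ _ e; rewrite -e in af.
- move=> _ _ e ea; move: bf; rewrite -e ea inE => /eqP e'.
  by rewrite e' eqxx in ab.
move=> /andP[]; rewrite inE negb_or => /andP[s01 _] _ /andP[_ srt] e ea.
subst s0.
congr (_ - expv _); apply: (mle_anti mo).
  have : s1 \in msupp f by rewrite -e !inE eqxx orbT.
  by case/top=> // e'; rewrite e' eqxx in s01.
move: bf; rewrite -e !inE eq_sym (negPf ab) /= => /predU1P[->|bs].
  exact: (mle_refl mo).
by have /allP := order_path_min mge_trans srt; apply.
Qed.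

Lemma two_largest_exists f : (1 < size (msupp f))%N ->
  exists a b, two_largest f a b.
Proof.
have : size (monomials_decreasing le f) = size (msupp f) by rewrite size_sort.
move: (monomials_decreasing_sorted f) (mem_monomials_decreasing f).
have : uniq (monomials_decreasing le f) by rewrite sort_uniq msupp_uniq.
case: (monomials_decreasing le f) => [|a [|b s]] /=; try by move=> _ _ _ <-.
move=> /andP[]; rewrite inE negb_or => /andP[ab _] _ /andP[ba srt] e _ _.
exists a, b; split=> //; rewrite -?e ?inE ?eqxx ?orbT // => c.
rewrite -e !inE => /or3P[/eqP->|/eqP->|cs]; first by left.
  by right; apply: (mle_refl mo).
by right; have /allP := order_path_min mge_trans srt; apply.
Qed.

Lemma two_largest_size f a b : two_largest f a b -> (1 < size (msupp f))%N.
Proof.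
case=> af bf ab _ _; case: (msupp f) af bf => [|x [|y s]] //.
by rewrite !inE => /eqP <- /eqP e; rewrite e eqxx in ab.
Qed.

Lemma msuppMX_mem f a b :
  reflect (exists2 c, c \in msupp f & b = (a + c)%MM) (b \in msupp (f * 'X_[a])).
Proof. by rewrite (perm_mem (msuppMX f a)); apply: mapP. Qed.

(** The two largest monomials of [f * (x^c + x^d)] both come from the leading
    term of [f] as soon as [x^c] and [x^d] are closer to each other than the two
    largest monomials of [f]. *)
Lemma two_largest_mul f a b c d :
    two_largest f a b -> le d c -> c != d ->
    le (b + c)%MM (a + d)%MM -> (b + c != a + d)%MM ->
  two_largest (f * ('X_[c] + 'X_[d])) (a + c)%MM (a + d)%MM.
Proof.
move=> [af bf ab ba top] dc cd bcad ne; rewrite mulrDr.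
have le_a x : x \in msupp f -> le x a.
  by move=> /top[->|xb]; [exact: (mle_refl mo)|exact: (mle_trans mo) xb ba].
have acN : (a + c)%MM \notin msupp (f * 'X_[k, d]).
  apply/msuppMX_mem => -[x xf e]; case/negP: cd; apply/eqP/(mle_anti mo) => //.
  by rewrite -(mle_add2l mo a) e addmC (mle_add2r mo) le_a.
have adN : (a + d)%MM \notin msupp (f * 'X_[k, c]).
  apply/msuppMX_mem => -[x /top[->|xb]] e.
    by move: cd; rewrite -(eqm_add2l a) e addmC eqxx.
  case/negP: ne; apply/eqP/(mle_anti mo) => //.
  by rewrite e addmC (mle_add2r mo).
split.
- rewrite mcoeff_msupp mcoeffD (memN_msupp_eq0 acN) addr0 addmC mcoeffMX.
  by rewrite -mcoeff_msupp.
- rewrite mcoeff_msupp mcoeffD (memN_msupp_eq0 adN) add0r addmC mcoeffMX.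
  by rewrite -mcoeff_msupp.
- by rewrite eqm_add2l.
- by rewrite (mle_add2l mo).
move=> x /msuppD_le; rewrite mem_cat => /orP[] /msuppMX_mem[y yf ->].
  case/top: yf => [->|yb]; [left; exact: addmC|right].
  by apply: (mle_trans mo) bcad; rewrite addmC (mle_add2r mo).
by right; rewrite addmC (mle_add2r mo) le_a.
Qed.
End LeadingTerms.

(** * Convexity of the lattice of toric exponents *)

Section ToricLattice.
Variables (k : fieldType) (m : nat) (le : rel 'X_{1..m}).
Variables (I : idealr {mpoly k[m]}) (mo : monomial_order le).
Implicit Types (a b c d : 'X_{1..m}) (u v w : 'rV[int]_m).
Local Notation K := (toric_lattice le I).

Lemma toric_lattice_two_largest f a b : f \in I ->
  two_largest le f a b -> expv a - expv b \in K.
Proof.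
move=> fI ab; apply/asboolP => H HS; apply: HS; exists f; split=> //.
  exact: two_largest_size ab.
by rewrite (torexp_two_largest mo ab).
Qed.

(** If [u = c - d], then multiplying [f] by the binomial [x^c + x^d] turns [u]
    into a toric exponent; only the case where [u] is the toric exponent of [f]
    itself has to be set aside, as two terms may then cancel. *)
Lemma toric_lattice_below f a b u : f \in I -> two_largest le f a b ->
  nonneg le u -> nonneg le (expv a - expv b - u) -> u \in K.
Proof.
move=> fI ab [c [d [-> dc]]].
have [->|cd] := eqVneq c d; first by rewrite subrr => _; apply: rpred0.
rewrite opprB addrACA -opprD -!expvD => /(nonneg_expv mo) bcad.
have [/esym e|ne] := eqVneq (b + c)%MM (a + d)%MM.
  have -> : expv c - expv d = expv a - expv b.
    by apply/eqP; rewrite subr_eq addrAC eq_sym subr_eq -!expvD e addmC.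
  exact: toric_lattice_two_largest fI ab.
have := toric_lattice_two_largest (idealMr ('X_[c] + 'X_[d]) fI).
rewrite mulrC => /(_ _ _ (two_largest_mul mo ab dc cd bcad ne)).
by rewrite !expvD opprD addrACA subrr add0r.
Qed.

(** The vectors [v] such that all of the interval from [0] to the absolute value
    of [v] lies in [K]: this is the largest convex subgroup contained in [K]. *)
Definition convex_core : {pred 'rV[int]_m} := fun v =>
  `[< forall u, nonneg le u -> nonneg le (v - u) \/ nonneg le (- v - u) ->
      u \in K >].

(** For the sum of [v] and [w], let [u] be between [0] and [v + w].  Either
    [u <= v], or [u - v] is between [0] and [w]; in the latter case both [v] and
    [u - v] are in [K]. *)
Fact convex_core_zmod_closed : zmod_closed convex_core.
Proof.
have coreN v : v \in convex_core -> - v \in convex_core.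
  move=> /asboolP vK; apply/asboolP => u u0; rewrite opprK => vu.
  by apply: vK => //; case: vu; [right|left].
have aux v w u : v \in convex_core -> w \in convex_core -> nonneg le u ->
    nonneg le (v + w - u) -> u \in K.
  move=> /asboolP vK /asboolP wK u0 vwu.
  have vinK : v \in K.
    have [v0|v0] := nonneg_total mo v.
      by apply: vK => //; left; rewrite subrr; apply: nonneg0.
    by rewrite -rpredN; apply: vK => //; right; rewrite subrr; apply: nonneg0.
  have [vu|uv] := nonneg_total mo (v - u); first by apply: vK => //; left.
  rewrite -(subrK v u); apply: rpredD => //; apply: wK.
    by rewrite -opprB.
  by left; rewrite opprB addrA [w + v]addrC.
split=> [|v w vK wK].
  apply/asboolP => u u0; rewrite oppr0 add0r => - [] /(nonneg_anti mo u0) ->;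
    exact: rpred0.
apply/asboolP => u u0 [vwu|vwu].
  by apply: (aux v (- w) u) => //; apply: coreN.
by apply: (aux (- v) w u) => //; [apply: coreN|rewrite -[w]opprK -opprD].
Qed.

(** The convex core of [K] is a subgroup that contains the generators of [K],
    by [toric_lattice_below], so it is all of [K]. *)
Lemma toric_lattice_convex u v :
  v \in K -> nonneg le u -> nonneg le (v - u) -> u \in K.
Proof.
move=> vK u0 vu.
pose H : zmodClosed 'rV[int]_m := HB.pack convex_core
  (GRing.isZmodClosed.Build _ convex_core convex_core_zmod_closed).
have : v \in H.
  move/asboolP: vK; apply=> _ [f [fI fs ->]].
  have [a [b ab]] := two_largest_exists mo fs.
  apply/asboolP => w w0; rewrite (torexp_two_largest mo ab).
  case; first exact: toric_lattice_below ab w0.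
  move=> wab; have : w = 0.
    apply: (nonneg_anti mo) => //; rewrite -[- w](addNKr (expv a - expv b)).
    apply: (nonnegD mo) => //; apply/(nonneg_expv mo); by case: ab.
  by move=> ->; apply: rpred0.
by move=> /asboolP; apply=> //; left.
Qed.

(** The cone of nonnegative elements of the quotient of the exponent lattice by
    the toric exponents. *)
Definition nonneg_mod v := nonneg le v \/ v \in K.

(** If [x >= 0] and [y] is in [K] but [x + y < 0], then [x] lies between [0] and
    [- y], and convexity puts it in [K]. *)
Lemma nonneg_modD u v : nonneg_mod u -> nonneg_mod v -> nonneg_mod (u + v).
Proof.
have aux x y : nonneg le x -> y \in K -> nonneg_mod (x + y).
  move=> x0 yK; have [xy|xy] := nonneg_total mo (x + y); [by left|right].
  rewrite rpredD //; apply: (@toric_lattice_convex x (- y)) => //.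
    by rewrite rpredN.
  by rewrite addrC -opprD.
case=> hu [] hv.
- by left; apply: nonnegD.
- exact: aux.
- by rewrite addrC; apply: aux.
by right; apply: rpredD.
Qed.

Lemma nonneg_mod_anti v : nonneg_mod v -> nonneg_mod (- v) -> v \in K.
Proof.
case=> [v0|//] [v0'|]; last by rewrite rpredN.
by rewrite (nonneg_anti mo v0 v0') rpred0.
Qed.

(** A nonnegative [v] lies between [0] and any positive multiple [v *+ n]. *)
Lemma toric_lattice_torsion_free v n : (0 < n)%N -> v *+ n \in K -> v \in K.
Proof.
case: n => // n _.
have aux u : nonneg le u -> u *+ n.+1 \in K -> u \in K.
  move=> u0 uK; apply: (toric_lattice_convex uK u0).
  rewrite mulrS addrC addrK; elim: n {uK} => [|n IH].
    by rewrite mulr0n; apply: nonneg0.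
  by rewrite mulrS; apply: (nonnegD mo).
have [v0|v0] := nonneg_total mo v; first exact: aux.
by move=> vK; rewrite -rpredN; apply: aux => //; rewrite mulNrn rpredN.
Qed.

(** The preorder on monomials pulled back from the ordered group [Z^m / K]. *)
Definition cle a b := nonneg_mod (expv b - expv a).

Lemma cle_trans b a c : cle a b -> cle b c -> cle a c.
Proof. by move=> ab bc; rewrite /cle -(subrKA (expv b)); apply: nonneg_modD. Qed.

Lemma le_cle a b : le a b -> cle a b.
Proof. by move=> ab; left; apply/(nonneg_expv mo). Qed.

Lemma cle_refl a : cle a a.
Proof. exact/le_cle/(mle_refl mo). Qed.

Lemma cleD a b c d : cle a b -> cle c d -> cle (a + c)%MM (b + d)%MM.
Proof.
by move=> ab cd; rewrite /cle !expvD opprD addrACA; apply: nonneg_modD.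
Qed.

Lemma cle_anti a b : cle a b -> cle b a -> expv a - expv b \in K.
Proof. by move=> ab ba; apply: nonneg_mod_anti; rewrite // opprB. Qed.

Lemma not_cle a b : ~ cle a b -> le b a.
Proof.
by move=> nab; have /orP[/le_cle|] := mle_total mo a b.
Qed.

Definition clt a b := ~ cle b a.

Lemma clt_cle_trans b a c : clt a b -> cle b c -> clt a c.
Proof. by move=> ab bc ca; apply: ab; apply: cle_trans bc ca. Qed.

Lemma cle_clt_trans b a c : cle a b -> clt b c -> clt a c.
Proof. by move=> ab bc ca; apply: bc; apply: cle_trans ca ab. Qed.

Lemma cle_cltD a b c d : cle a b -> clt c d -> clt (a + c)%MM (b + d)%MM.
Proof.
move=> ab cd bdac; apply: cd; rewrite /cle.
have -> : expv c - expv d =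
    expv b - expv a + (expv (a + c)%MM - expv (b + d)%MM).
  rewrite !expvD [- (expv b + _)]opprD [X in _ = _ + X]addrACA.
  by rewrite -[expv b - _]opprB addKr.
exact: nonneg_modD.
Qed.

(** [mu_monomial] below shows that this is the value of [mu] at [x^a]. *)
Definition tf_class a : tf le I :=
  \pi_(tf le I) (\pi_{quot K} (- expv a)).

End ToricLattice.
Arguments tf_class {k m} le I a.

(** * Normal forms and the valuation *)

Section Valuation.
Variables (k : fieldType) (m : nat) (le : rel 'X_{1..m}).
Variables (I : idealr {mpoly k[m]}) (mo : monomial_order le).
Implicit Types (a b c d : 'X_{1..m}) (f g : {mpoly k[m]}).
Local Notation K := (toric_lattice le I).
Local Notation Q := (coordring I).

Lemma cls0P f : f \in I <-> cls I f = 0.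
Proof. by rewrite -[0](rmorph0 (cls I)) eq_cls subr0. Qed.

(** Division with remainder: the largest monomial is either kept, if it is
    standard, or cancelled by a scalar multiple of an element of the ideal with
    the same leading monomial, and what remains has only smaller monomials. *)
Lemma normal_form_exists f : exists h, cls I h = cls I f /\
  forall a, a \in msupp h -> standard le I a.
Proof.
pose has_nf f := exists h, cls I h = cls I f /\
  forall a, a \in msupp h -> standard le I a.
have nf0 : has_nf 0 by exists 0; split=> // a; rewrite msupp0.
suff bounded a : forall f, (forall b, b \in msupp f -> le b a) -> has_nf f.
  have [->//|f0] := eqVneq f 0.
  by apply: (bounded (lm le f)) => b; apply: (le_lm mo).
have [_ _ _ _ wf] := mo; elim/(well_founded_ind wf): a => a IH {}f fa.
have below g : (forall b, b \in msupp g -> le b a) -> g@_a = 0 -> has_nf g.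
  move=> ga ga0; have [->//|g0] := eqVneq g 0.
  have lg := lm_mem mo g0; apply: (IH (lm le g)) => [|b]; last exact: (le_lm mo).
  rewrite ga // andbT; apply/eqP => e.
  by move: lg; rewrite mcoeff_msupp e ga0 eqxx.
have cancel_lm g : (forall b, b \in msupp g -> le b a) -> g@_a = 1 ->
    has_nf (f - f@_a *: g).
  move=> ga g1; apply: below => [b|].
    by move=> /msuppB_le; rewrite mem_cat => /orP[/fa//|/msuppZ_le /ga].
  by rewrite mcoeffB mcoeffZ g1 mulr1 subrr.
have [st|nst] := pselect (standard le I a).
  (* a standard leading term is split off and put back after the reduction *)
  have [||h [hf hst]] := cancel_lm 'X_[a].
  - by move=> b; rewrite msuppX inE => /eqP ->; apply: (mle_refl mo).
  - by rewrite mcoeffX eqxx.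
  exists (h + f@_a *: 'X_[a]); split.
    by rewrite rmorphD /= hf rmorphB /= subrK.
  move=> b /msuppD_le; rewrite mem_cat => /orP[/hst//|/msuppZ_le].
  by rewrite msuppX inE => /eqP ->.
have [g [gI g0 ga]] : exists g, [/\ g \in I, g != 0 & lm le g = a].
  by apply: contrapT => N; apply: nst.
have gl : g@_a != 0 by rewrite -mcoeff_msupp -ga; apply: (lm_mem mo).
have [||h [hf hst]] := cancel_lm ((g@_a)^-1 *: g).
- by move=> b /msuppZ_le bg; rewrite -ga; apply: (le_lm mo).
- by rewrite mcoeffZ mulVf.
exists h; split=> //; rewrite hf rmorphB /= !clsZ (proj1 (cls0P g) gI).
by rewrite !scaler0 subr0.
Qed.

Lemma nfP (z : Q) : cls I (nf le z) = z /\
  forall a, a \in msupp (nf le z) -> standard le I a.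
Proof.
have [f ->] := cls_surj z; have [h hP] := normal_form_exists f.
exact: (@xgetI _ 0 [set g | cls I g = cls I f /\ _] h hP).
Qed.

Lemma nf_neq0 (z : Q) : z != 0 -> nf le z != 0.
Proof. by apply: contra => /eqP e; have [<- _] := nfP z; rewrite e rmorph0. Qed.

(** Otherwise the difference of the two polynomials, which is in the ideal,
    would have the standard monomial [lm (nf f)] as its leading monomial. *)
Lemma lm_nf_le f : cls I f != 0 -> le (lm le (nf le (cls I f))) (lm le f).
Proof.
set h := nf le _ => f0; have [hf hst] := nfP (cls I f); rewrite -/h in hf hst.
have hl := lm_mem mo (nf_neq0 f0); rewrite -/h in hl.
have [//|nle] := boolP (le (lm le h) (lm le f)).
case: (hst _ hl); exists (h - f).
have hN : lm le h \notin msupp f.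
  by apply: contra nle => /(le_lm mo).
have hs : lm le h \in msupp (h - f).
  by rewrite mcoeff_msupp mcoeffB (memN_msupp_eq0 hN) subr0 -mcoeff_msupp.
split.
- by apply/eq_cls.
- by apply: contraTneq hs => ->; rewrite msupp0.
apply: (lm_unique mo) => // b /msuppB_le; rewrite mem_cat => /orP[|].
  exact: (le_lm mo).
move=> /(le_lm mo) bf; apply: (mle_trans mo) bf _.
by have := mle_total mo (lm le h) (lm le f); rewrite (negPf nle).
Qed.

Lemma mu_class (z : Q) : mu le z = tf_class le I (lm le (nf le z)).
Proof. by []. Qed.

(** As [Z^m / K] has no torsion, dividing out the torsion identifies nothing
    more. *)
Lemma tf_class_eq a b :
  tf_class le I a = tf_class le I b <-> expv a - expv b \in K.
Proof.
have piK v : (\pi_{quot K} v = 0) <-> v \in K.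
  rewrite -[0](raddf0 (\pi_{quot K})) -[X in X \in _]subr0 Quotient.idealrBE.
  by split=> /eqP.
split=> [/eqP|abK].
  rewrite -Quotient.idealrBE -raddfB => /asboolP[n n0].
  rewrite -raddfMn /= => /piK /(toric_lattice_torsion_free mo n0).
  by rewrite opprK addrC -opprB rpredN.
congr (\pi_(tf le I) _); apply/eqP; rewrite -subr_eq0 -raddfB; apply/eqP/piK.
by rewrite opprK addrC -opprB rpredN.
Qed.

Lemma tf_classD a b :
  tf_class le I (a + b)%MM = tf_class le I a + tf_class le I b.
Proof. by rewrite /tf_class expvD opprD !raddfD. Qed.

Lemma tf_class0 : tf_class le I 0%MM = 0.
Proof. by apply: (addrI (tf_class le I 0%MM)); rewrite -tf_classD addm0 addr0. Qed.

Section MonomialFree.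
Hypothesis noX : forall a : 'X_{1..m}, 'X_[k, a] \notin I.

Lemma cls_monomial_neq0 a : cls_monomial I a != 0.
Proof. by apply/eqP => /cls0P; apply/negP/noX. Qed.

(** If [x^b] is the leading monomial of the normal form [h] of [x^a] and differs
    from [x^a], then [x^a] and [x^b] are the two largest monomials of [x^a - h],
    so that [a - b] is a toric exponent. *)
Lemma mu_monomial a : mu le (cls_monomial I a) = tf_class le I a.
Proof.
have a0 := cls_monomial_neq0 a; rewrite mu_class; apply/tf_class_eq.
set h := nf le _; set b := lm le h.
have hb : b \in msupp h := lm_mem mo (nf_neq0 a0).
have xh : 'X_[a] - h \in I by apply/eq_cls; have [->] := nfP (cls_monomial I a).
have ba : le b a.
  have -> : a = lm le ('X_[a] : {mpoly k[m]}).
    apply/esym/(lm_unique mo) => [|b']; rewrite msuppX inE // => /eqP ->.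
    exact: (mle_refl mo).
  exact: lm_nf_le.
have [->|ab] := eqVneq a b; first by rewrite subrr rpred0.
rewrite -rpredN opprB.
have aN : a \notin msupp h.
  by apply/negP => /(le_lm mo) ab'; case/eqP: ab; apply: (mle_anti mo).
apply: (toric_lattice_two_largest mo xh); split=> //.
- by rewrite mcoeff_msupp mcoeffB mcoeffX eqxx (memN_msupp_eq0 aN) subr0 oner_eq0.
- rewrite mcoeff_msupp mcoeffB mcoeffX (negPf ab) sub0r oppr_eq0.
  by rewrite -mcoeff_msupp.
move=> c /msuppB_le; rewrite mem_cat msuppX inE => /orP[/eqP|/(le_lm mo)].
  by left.
by right.
Qed.

Lemma mu_imageE (g : tf le I) : mu_image g -> exists a, g = tf_class le I a.
Proof. by case=> z _ <-; exists (lm le (nf le z)). Qed.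

Lemma smallest_monomial_exists a :
  exists b, smallest_monomial (tf_class le I a) b.
Proof.
have [_ _ _ _ wf] := mo.
pose S b := mu le (cls_monomial I b) = tf_class le I a.
have : S a by exact: mu_monomial.
elim/(well_founded_ind wf): {1}a => b IH Sb.
have [[c [Sc cb]]|N] := pselect (exists c, S c /\ ((c != b) && le c b)).
  exact: (IH c cb Sc).
exists b; split=> // c Sc; have /orP[//|cb] := mle_total mo b c.
have [->|cb'] := eqVneq c b; first exact: (mle_refl mo).
by case: N; exists c; rewrite cb'.
Qed.

(** Two monomials with different classes compare like these classes in the
    ordered group [Z^m / K], whichever representatives are compared. *)
Lemma mu_ltP a b : mu_lt (tf_class le I a) (tf_class le I b) <-> clt le I b a.
Proof.
have cleE c d : tf_class le I c = tf_class le I d -> cle le I c d.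
  by move/tf_class_eq => cd; right; rewrite -rpredN opprB.
split=> [[a' [b' [sa sb ne b'a']]] ab|ba].
  have [sa1 _] := sa; have [sb1 _] := sb.
  rewrite !mu_monomial in sa1 sb1.
  have ab_eq : tf_class le I a = tf_class le I b.
    apply/tf_class_eq/cle_anti => //; apply: (@cle_trans _ _ _ _ mo b').
      exact/cleE/esym.
    by apply: (@cle_trans _ _ _ _ mo a'); [exact: le_cle|exact: cleE].
  rewrite ab_eq in sa; case/eqP: ne; apply: (mle_anti mo) => //.
  by case: sa => _; apply; case: sb.
have [a' sa] := smallest_monomial_exists a.
have [b' sb] := smallest_monomial_exists b.
have [sa1 _] := sa; have [sb1 _] := sb.
rewrite !mu_monomial in sa1 sb1.
have ba' : clt le I b' a'.
  apply: (cle_clt_trans mo (cleE _ _ sb1)).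
  exact: (clt_cle_trans mo ba (cleE _ _ (esym sa1))).
exists a', b'; split=> //; last exact: (not_cle mo ba').
by apply/eqP => e; apply: ba'; rewrite e; apply: (cle_refl I mo).
Qed.

Lemma mu_leP a b : mu_le (tf_class le I a) (tf_class le I b) <-> cle le I b a.
Proof.
split=> [[/tf_class_eq ab|/mu_ltP nba]|ba].
- by right.
- exact/(le_cle I mo)/(not_cle mo nba).
have [ab|ab] := pselect (cle le I a b); last by right; apply/mu_ltP.
by left; apply/tf_class_eq/cle_anti.
Qed.

(** For a condition inherited by smaller monomials, testing the leading monomial
    of the normal form amounts to testing all monomials of some representative.
    This is what makes sums and products of elements tractable, as these have
    obvious representatives but no obvious normal form. *)
Lemma lm_nf_down (D : 'X_{1..m} -> Prop) (z : Q) :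
    (forall a b, le a b -> D b -> D a) ->
  (z != 0 /\ D (lm le (nf le z)) \/ z = 0) <->
  exists2 f, cls I f = z & forall a, a \in msupp f -> D a.
Proof.
move=> Ddown; split=> [[[z0 Dz]|->]|[f <- Df]].
- exists (nf le z) => [|a /(le_lm mo) az]; first by have [] := nfP z.
  exact: Ddown az Dz.
- by exists 0 => [|a]; [exact: rmorph0|rewrite msupp0].
have [->|f0] := eqVneq (cls I f) 0; [by right|left; split=> //].
apply: (Ddown _ _ (lm_nf_le f0)); apply/Df/(lm_mem mo).
by apply: contraNneq f0 => ->; rewrite rmorph0.
Qed.

Lemma F_geP a (z : Q) : F_ge (tf_class le I a) z <->
  exists2 f, cls I f = z & forall b, b \in msupp f -> cle le I b a.
Proof.
rewrite -(@lm_nf_down (fun b => cle le I b a)) => [|b c bc].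
  by rewrite /F_ge /= mu_class; split=> -[[z0 /mu_leP]|->]; by [left|right].
exact/(cle_trans mo)/(le_cle I mo bc).
Qed.

Lemma F_gtP a (z : Q) : F_gt (tf_class le I a) z <->
  exists2 f, cls I f = z & forall b, b \in msupp f -> clt le I b a.
Proof.
rewrite -(@lm_nf_down (fun b => clt le I b a)) => [|b c bc].
  by rewrite /F_gt /= mu_class; split=> -[[z0 /mu_ltP]|->]; by [left|right].
exact/(cle_clt_trans mo)/(le_cle I mo bc).
Qed.

Lemma F_gt_outside (g : tf le I) (z : Q) : ~ mu_image g -> F_gt g z -> z = 0.
Proof.
move=> gN gz; apply: (F_ge_outside noX gN).
by case: gz => [[z0 gz]|->]; [left; split=> //; right|right].
Qed.

(** Reduces statements about the filtration in all degrees to the degrees of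
    monomials. *)
Lemma degreeP (g : tf le I) : (exists a, g = tf_class le I a) \/
  (forall z : Q, F_ge g z -> z = 0) /\ (forall z : Q, F_gt g z -> z = 0).
Proof.
have [gI|gN] := pselect (mu_image g); [left; exact: mu_imageE|right].
by split=> z; [exact: (F_ge_outside noX)|exact: F_gt_outside].
Qed.

Lemma representative_linear (D : 'X_{1..m} -> Prop) (c : k) (x y : Q) :
    (exists2 f, cls I f = x & forall a, a \in msupp f -> D a) ->
    (exists2 f, cls I f = y & forall a, a \in msupp f -> D a) ->
  exists2 f, cls I f = c *: x + y & forall a, a \in msupp f -> D a.
Proof.
move=> [f <- Df] [g <- Dg]; exists (c *: f + g).
  by rewrite rmorphD /= clsZ.
by move=> a /msuppD_le; rewrite mem_cat => /orP[/msuppZ_le /Df|/Dg].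
Qed.

Lemma representative_mul (D E F : 'X_{1..m} -> Prop) (x y : Q) :
    (forall a b, D a -> E b -> F (a + b)%MM) ->
    (exists2 f, cls I f = x & forall a, a \in msupp f -> D a) ->
    (exists2 f, cls I f = y & forall a, a \in msupp f -> E a) ->
  exists2 f, cls I f = x * y & forall a, a \in msupp f -> F a.
Proof.
move=> DEF [f <- Df] [g <- Eg]; exists (f * g); first by rewrite rmorphM.
by move=> c /msuppM_le /allpairsP[[a b] /= [/Df Da /Eg Eb ->]]; apply: DEF.
Qed.

Lemma F_filtration : is_filtration (@F_ge k m le I) (@F_gt k m le I).
Proof.
have lin0 (c : k) (x y : Q) : x = 0 -> y = 0 -> c *: x + y = 0.
  by move=> -> ->; rewrite scaler0 addr0.
split.
- by right.
- by right.
- move=> g c x y; have [[a ->]|[ge0 _]] := degreeP g.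
    by move=> /F_geP xa /F_geP ya; apply/F_geP/representative_linear.
  by move=> /ge0 x0 /ge0 y0; right; apply: lin0.
- move=> g c x y; have [[a ->]|[_ gt0]] := degreeP g.
    by move=> /F_gtP xa /F_gtP ya; apply/F_gtP/representative_linear.
  by move=> /gt0 x0 /gt0 y0; right; apply: lin0.
- by move=> g x [[x0 gx]|->]; [left; split=> //; right|right].
- move=> g h x y; have [[a ->]|[ge0 _]] := degreeP g; last first.
    by move=> /ge0 -> _; right; rewrite mul0r.
  have [[b ->]|[ge0 _]] := degreeP h; last first.
    by move=> _ /ge0 ->; right; rewrite mulr0.
  rewrite -tf_classD => /F_geP xa /F_geP yb; apply/F_geP.
  by apply: representative_mul xa yb => c d; apply: cleD.
- move=> g h x y; have [[a ->]|[ge0 _]] := degreeP g; last first.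
    by move=> /ge0 -> _; right; rewrite mul0r.
  have [[b ->]|[_ gt0]] := degreeP h; last first.
    by move=> _ /gt0 ->; right; rewrite mulr0.
  rewrite -tf_classD => /F_geP xa /F_gtP yb; apply/F_gtP.
  by apply: representative_mul xa yb => c d; apply: cle_cltD.
- rewrite -tf_class0; apply/F_geP; exists 'X_[0%MM].
    by rewrite mpolyX0 rmorph1.
  by move=> b; rewrite msuppX inE => /eqP ->; apply: (cle_refl I mo).
rewrite -tf_class0 => -[[_]|/eqP]; last by rewrite oner_eq0.
have -> : 1 = cls_monomial I 0%MM by rewrite /cls_monomial mpolyX0 rmorph1.
by rewrite mu_monomial => /mu_ltP; apply; apply: (cle_refl I mo).
Qed.

End MonomialFree.
End Valuation.

(** * Generation of the associated graded algebra *)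

Section Generation.
Variables (k : fieldType) (m : nat) (le : rel 'X_{1..m}).
Variables (I : idealr {mpoly k[m]}) (mo : monomial_order le).
Hypothesis noX : forall a : 'X_{1..m}, 'X_[k, a] \notin I.
Variable H : is_filtration (@F_ge k m le I) (@F_gt k m le I).
Implicit Types (a b : 'X_{1..m}).

Lemma F_ge_mu (z : coordring I) : F_ge (mu le z) z.
Proof. by have [->|z0] := eqVneq z 0; [right|left; split=> //; left]. Qed.

Lemma gr_in0 g : gr_in H g 0 = 0.
Proof.
have g0 : F_ge g 0 by right.
have := gr_in_linear H 1 g0 g0; rewrite scaler0 addr0 scale1r => e.
by apply: (addrI (gr_in H g 0)); rewrite -e addr0.
Qed.

Lemma gr_in_gt g z : F_gt g z -> gr_in H g z = 0.
Proof.
move=> gz; rewrite -(gr_in0 g); apply/gr_in_eq; first exact: (fgt_ge H).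
  by right.
by rewrite subr0.
Qed.

Lemma gr_in_sum g (s : seq 'X_{1..m}) (c : 'X_{1..m} -> k)
    (x : 'X_{1..m} -> coordring I) :
    (forall b, b \in s -> F_ge g (x b)) ->
  gr_in H g (\sum_(b <- s) c b *: x b) = \sum_(b <- s) c b *: gr_in H g (x b).
Proof.
elim: s => [|b s IH] xg; first by rewrite !big_nil gr_in0.
rewrite !big_cons gr_in_linear ?IH //.
- by move=> d ds; apply: xg; rewrite inE ds orbT.
- by apply: xg; rewrite mem_head.
apply: (fge_sum H) => d ds; rewrite -[_ *: _]addr0; apply: (fge_linear H).
  by apply: xg; rewrite inE ds orbT.
exact: (fge0 H).
Qed.

Variable P : {pred gr H}.
Hypothesis P_subalg : subalg_closed P.
Hypothesis P_variables : forall i : 'I_m,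
  gr_in H (mu le (cls_monomial I U_(i))) (cls_monomial I U_(i)) \in P.

Let P_lin : GRing.linear_closed P. Proof. by case: P_subalg. Qed.
Let P_mul : GRing.mulr_2closed P. Proof. by case: P_subalg. Qed.
Let P1 : 1 \in P. Proof. by case: P_subalg. Qed.
Let P0 : 0 \in P. Proof. by rewrite -(subrr (1 : gr H)) addrC -scaleN1r P_lin. Qed.

(** The values of [mu] at monomials add up, so that the image of a product of
    monomials in the graded algebra is the product of their images. *)
Lemma gr_monomial_generated a :
  gr_in H (mu le (cls_monomial I a)) (cls_monomial I a) \in P.
Proof.
pose good b := gr_in H (mu le (cls_monomial I b)) (cls_monomial I b) \in P.
have mulP b c : good b -> good c -> good (b + c)%MM.
  move=> bP cP; have := P_mul bP cP.
  rewrite gr_inM; try exact: F_ge_mu.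
  rewrite !(mu_monomial mo noX) -(tf_classD le I) /good (mu_monomial mo noX).
  by rewrite /cls_monomial mpolyXD rmorphM.
have oneP : good 0%MM.
  rewrite /good (mu_monomial mo noX) tf_class0 /cls_monomial mpolyX0 rmorph1.
  by rewrite gr_in1.
suff : good a by [].
rewrite (multinomUE_id a).
apply: (big_ind good); [exact: oneP|exact: mulP|move=> i _].
elim: (a i) => [|n IH]; first by rewrite mulm0n; exact: oneP.
rewrite mulmS; apply: mulP; [exact: P_variables|exact: IH].
Qed.

(** Of a representative with exponents at most [a] modulo [K], the terms with
    exponent strictly below [a] vanish in degree [- a], and the other terms are
    scalar multiples of monomials whose own degree is [- a]. *)
Lemma gr_component_generated g (z : coordring I) : F_ge g z -> gr_in H g z \in P.
Proof.
have [[a ->]|[ge0 _]] := degreeP noX g; last by move=> /ge0 ->; rewrite gr_in0.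
move=> /(F_geP mo noX)[f <- fa].
rewrite (mpolyE f) rmorph_sum /=.
under eq_bigr do rewrite clsZ.
have ge_a b : b \in msupp f -> F_ge (tf_class le I a) (cls_monomial I b).
  move=> /fa ba; apply/(F_geP mo noX); exists 'X_[b] => // c.
  by rewrite msuppX inE => /eqP ->.
rewrite gr_in_sum //; rewrite big_seq; apply: (big_ind (fun x => x \in P)) => //.
  by move=> x y xP yP; rewrite -[x]scale1r P_lin.
move=> b bf; rewrite -[_ *: _]addr0; apply: P_lin => //.
have [ab|ab] := pselect (cle le I a b).
  have -> : tf_class le I a = mu le (cls_monomial I b).
    by rewrite (mu_monomial mo noX);
       apply/(tf_class_eq _ mo)/(cle_anti mo ab)/fa.
  exact: gr_monomial_generated.
rewrite gr_in_gt //; apply/(F_gtP mo noX); exists 'X_[b] => // c.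
by rewrite msuppX inE => /eqP ->.
Qed.

Lemma gr_generated (z : gr H) : z \in P.
Proof.
have [s _ [x xF ->]] := gr_in_span z.
apply: (big_ind (fun x => x \in P)) => // [u v uP vP|g _].
  by rewrite -[u]scale1r P_lin.
exact: gr_component_generated.
Qed.
End Generation.

Theorem corollary4p4 (k : fieldType) (m : nat) (le : rel 'X_{1..m})
    (I : prime_idealr {mpoly k[m]}) :
  monomial_order le ->
  (forall a : 'X_{1..m}, 'X_[k, a] \notin I) ->
  (forall g : tf le I, g != 0 -> mu_image g ->
     exists! a : 'X_{1..m}, standard le I a /\ mu le (cls_monomial I a) = g) ->
  khovanskii_basis le [set cls I ('X_i : {mpoly k[m]}) | i in [set: 'I_m]].
Proof.
move=> mo noX _; split=> [_ [i _ <-]|]; first exact: cls_monomial_neq0.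
exists (F_filtration mo noX) => P P_subalg P_gen.
apply: (gr_generated mo noX) => // i.
by apply: P_gen; exists (cls_monomial I U_(i)) => //; exists i.
Qed.
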